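(* Let $m$ and $n$ be positive integers and let $\mathcal{R}=R_1\times R_2\times\dots\times R_m$ be a commutative finite principal ideal ring, where $R_1,R_2,\dots,R_m$ are commutative finite chain rings. For $1\le i\le m$ let $\phi_i:\mathcal{R}\to R_i$ be the projection $\phi_i((r_1,r_2,\dots,r_m))=r_i$. Then for every $r\in\mathcal{R}$, $$d_n(\mathcal{R},r)=d_n(R_1,\phi_1(r))\,d_n(R_2,\phi_2(r))\cdots d_n(R_m,\phi_m(r)).$$
   Context: A commutative finite principal ideal ring is a finite commutative ring with identity $1\neq 0$ in which every ideal is principal. A commutative finite chain ring is a finite commutative ring with identity $1\neq 0$ whose ideals are linearly ordered by inclusion. For a commutative ring $S$ and $a\in S$, $d_n(S,a)$ denotes the number of $n\times n$ matrices over $S$ whose determinant is $a$. *)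

(* Defs.v *)
From HB Require Import structures.
From mathcomp Require Import all_boot all_order all_algebra.

Set Implicit Arguments.
Unset Strict Implicit.
Unset Printing Implicit Defensive.

Import GRing.Theory.
Local Open Scope ring_scope.

(* [finComPzRingType] does not assume 1 != 0, so that the product below is a
   ring for every index type; the condition 1 != 0 is imposed explicitly in
   [principal_ideal_ring] and [chain_ring]. *)

Section Ideals.
Variable S : finComPzRingType.

(* The whole ring counts as an ideal, unlike with [idealr_closed]. *)
Definition is_ideal (J : {set S}) : Prop :=
  zmod_closed J /\ forall a x : S, x \in J -> a * x \in J.

Definition principal_ideal (a : S) : {set S} := [set a * x | x : S].

Definition principal_ideal_ring : Prop :=
  (1 : S) != 0 /\
  forall J : {set S}, is_ideal J -> exists a : S, J = principal_ideal a.

Definition chain_ring : Prop :=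
  (1 : S) != 0 /\
  forall J K : {set S}, is_ideal J -> is_ideal K ->
    (J \subset K) || (K \subset J).

End Ideals.

Definition det_count (n : nat) (S : finComPzRingType) (a : S) : nat :=
  #|[set A : 'M[S]_n | \det A == a]|.

Definition ring_prod (I : finType) (R : I -> finComPzRingType) : Type :=
  {dffun forall i, R i}.

Section RingProduct.
Variables (I : finType) (R : I -> finComPzRingType).
Local Notation P := (ring_prod R).

HB.instance Definition _ := Finite.copy P {dffun forall i, R i}.

Definition prod_proj (i : I) (r : P) : R i :=
  (r : {dffun forall i, R i}) i.

Definition rprod_zero : P := [ffun i : I => 0 : R i].
Definition rprod_one : P := [ffun i : I => 1 : R i].
Definition rprod_opp (r : P) : P := [ffun i : I => - prod_proj i r].
Definition rprod_add (r s : P) : P :=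
  [ffun i : I => prod_proj i r + prod_proj i s].
Definition rprod_mul (r s : P) : P :=
  [ffun i : I => prod_proj i r * prod_proj i s].

Lemma prod_projP (r s : P) :
  (forall i, prod_proj i r = prod_proj i s) -> r = s.
Proof. by move=> rs; apply/ffunP. Qed.

Lemma prod_projE (F : forall i, R i) (i : I) :
  prod_proj i [ffun j : I => F j] = F i.
Proof. exact: ffunE. Qed.

Fact rprod_addA : associative rprod_add.
Proof. by move=> r s t; apply: prod_projP => i; rewrite !prod_projE addrA. Qed.
Fact rprod_addC : commutative rprod_add.
Proof. by move=> r s; apply: prod_projP => i; rewrite !prod_projE addrC. Qed.
Fact rprod_add0 : left_id rprod_zero rprod_add.
Proof. by move=> r; apply: prod_projP => i; rewrite !prod_projE add0r. Qed.
Fact rprod_addN : left_inverse rprod_zero rprod_opp rprod_add.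
Proof. by move=> r; apply: prod_projP => i; rewrite !prod_projE addNr. Qed.
Fact rprod_mulA : associative rprod_mul.
Proof. by move=> r s t; apply: prod_projP => i; rewrite !prod_projE mulrA. Qed.
Fact rprod_mulC : commutative rprod_mul.
Proof. by move=> r s; apply: prod_projP => i; rewrite !prod_projE mulrC. Qed.
Fact rprod_mul1 : left_id rprod_one rprod_mul.
Proof. by move=> r; apply: prod_projP => i; rewrite !prod_projE mul1r. Qed.
Fact rprod_mulDl : left_distributive rprod_mul rprod_add.
Proof. by move=> r s t; apply: prod_projP => i; rewrite !prod_projE mulrDl. Qed.

HB.instance Definition _ := GRing.isZmodule.Build P
  rprod_addA rprod_addC rprod_add0 rprod_addN.
HB.instance Definition _ := GRing.Zmodule_isComPzRing.Build P
  rprod_mulA rprod_mulC rprod_mul1 rprod_mulDl.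

Variable i : I.
Fact prod_proj_zmod : zmod_morphism (@prod_proj i).
Proof. by move=> r s; rewrite !prod_projE. Qed.
Fact prod_proj_monoid : monoid_morphism (@prod_proj i).
Proof. by split=> [|r s]; rewrite prod_projE. Qed.
HB.instance Definition _ :=
  GRing.isZmodMorphism.Build P (R i) (@prod_proj i) prod_proj_zmod.
HB.instance Definition _ :=
  GRing.isMonoidMorphism.Build P (R i) (@prod_proj i) prod_proj_monoid.

End RingProduct.

(* Main.v *)
Require Import Defs.
From HB Require Import structures.
From mathcomp Require Import all_boot all_order all_algebra.

(** A matrix over a product ring is the same thing as a family of matrices, one
    over each factor ([mx_components_bij]). The determinant is a polynomial in
    the entries with integer coefficients, so it commutes with the projections,
    which are ring morphisms; hence [\det A = r] holds if and only if it holds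
    in every factor ([det_components]). The matrices of determinant [r] are
    thus in bijection with the choice functions of the family of sets of
    matrices over the factors with determinants the components of [r], and
    there are as many of these as the product of the cardinals
    ([det_count_prod]). *)

Section Components.
Variables (I : finType) (R : I -> finComPzRingType).
Local Open Scope ring_scope.

Definition mx_components (p q : nat) (A : 'M[ring_prod R]_(p, q)) :
    {dffun forall i, 'M[R i]_(p, q)} :=
  [ffun i => map_mx (@prod_proj I R i) A].

Lemma mx_components_bij (p q : nat) : bijective (@mx_components p q).
Proof.
exists (fun B : {dffun forall i, 'M[R i]_(p, q)} =>
  \matrix_(j, k) ([ffun i => B i j k] : ring_prod R)) => [A | B].
  apply/matrixP => j k; apply: prod_projP => i.
  by rewrite mxE prod_projE ffunE mxE.
by apply/ffunP => i; apply/matrixP => j k; rewrite ffunE !mxE prod_projE.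
Qed.

Variables (n : nat) (r : ring_prod R).

(** The right-hand side is phrased with [family] so that [card_family] can
    count it. *)
Lemma det_components (A : 'M[ring_prod R]_n) :
  (\det A == r) =
    (mx_components _ _ A \in
       family (fun i => [pred B : 'M[R i]_n | \det B == prod_proj i r])).
Proof.
apply/eqP/familyP => [detA i | detA].
  by rewrite ffunE inE det_map_mx detA.
by apply: prod_projP => i; have:= detA i; rewrite ffunE inE det_map_mx => /eqP.
Qed.

Lemma det_count_prod :
  det_count n r = (\prod_(i : I) det_count n (prod_proj i r))%N.
Proof.
pose F i := [pred B : 'M[R i]_n | \det B == prod_proj i r].
have := card_family F; rewrite foldrE big_image.
rewrite -(on_card_preimset (onW_bij _ (mx_components_bij n n))).
under [in RHS]eq_bigr do rewrite -cardsE.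
by move<-; apply: eq_card => A; rewrite !inE det_components.
Qed.

End Components.

Theorem theorem4p1 (m n : nat) (hm : (0 < m)%N) (hn : (0 < n)%N)
  (R : 'I_m -> finComPzRingType)
  (hR : forall i : 'I_m, chain_ring (R i))
  (hP : principal_ideal_ring (ring_prod R))
  (r : ring_prod R) :
  det_count n r = (\prod_(i < m) det_count n (prod_proj i r))%N.
Proof. exact: det_count_prod. Qed.
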